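(* Let $G$ be a group of infinite order $\kappa$, and let $I$ be an index set (in some ordered field $\mathbb{F}$) with $|I|=|G|$. If $G$ has a directed $T_D$-terrace for $I$, then there is a $D$-complete Latin square of order $|G|$ on $I$. Further, if $G$ has a directed $T_\infty$-terrace for $I$, then there is a Vatican square of order $|G|$ on $I$.
   Context: Let $\mathbb{F}$ be an ordered field and $I\subseteq\mathbb{F}$. For $d\in\mathbb{F}^+$ put $I_{(d)}=\{i\in I: i+d\in I\}$. $I$ is an index set if $|I|=|\mathbb{F}|$ and for every $d\in\mathbb{F}^+$ either $|I_{(d)}|=|\mathbb{F}|$ or $I_{(d)}=\emptyset$. A Latin square on $I$ with symbol set $X$ is a function $L:I\times I\to X$ such that for each $i\in I$ both $j\mapsto L(i,j)$ and $j\mapsto L(j,i)$ are bijections $I\to X$; its order is $|X|$. For $D\in\mathbb{F}^+$, $L$ is $D$-complete if for every $d\in\mathbb{F}$ with $0<d\le D$ and $I_{(d)}\neq\emptyset$, and every ordered pair $(x,y)$ of distinct symbols, there is exactly one pair $(i,j)$ with $j\in I_{(d)}$, $L(i,j)=x$, $L(i,j+d)=y$ (rows), and exactly one pair $(i,j)$ with $i\in I_{(d)}$, $L(i,j)=x$, $L(i+d,j)=y$ (columns). $L$ is Vatican if this holds for every $d\in\mathbb{F}^+$ with $I_{(d)}\ne\emptyset$. For a group $G$ with $|G|=|I|$ and a bijection $\mathbf a:I\to G$, define for each $d\in\mathbb{F}^+$ with $I_{(d)}\neq\emptyset$ the map $\mathbf a_{(d)}:I_{(d)}\to G\setminus\{e\}$,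 $\mathbf a_{(d)}(i)=\mathbf a(i)^{-1}\mathbf a(i+d)$. $\mathbf a$ is a directed $T_D$-terrace for $G$ (for $I$) if $\mathbf a_{(d)}$ is a bijection for all $d\in\mathbb{F}^+$ with $d\le D$ and $I_{(d)}\neq\emptyset$; it is a directed $T_\infty$-terrace if $\mathbf a_{(d)}$ is a bijection for all $d\in\mathbb{F}^+$ with $I_{(d)}\ne\emptyset$. *)

(* Defs.v *)
From mathcomp Require Import all_boot all_order all_algebra.
From mathcomp Require Import boolp classical_sets functions cardinality.

Set Implicit Arguments.
Unset Strict Implicit.
Unset Printing Implicit Defensive.

Import Order.TTheory GRing.Theory Num.Theory.
Local Open Scope classical_set_scope.
Local Open Scope card_scope.
Local Open Scope ring_scope.

(* The index set I is a subset of F, and maps out of I (terraces) or I x I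
   (Latin squares) are total functions on F of which only the values on I
   matter: every condition below restricts its arguments to I. *)

Section IndexSets.
Context {F : realFieldType}.
Implicit Types (I : set F) (d : F).

(* I_(d) *)
Definition shift_set I d : set F := [set i | I i /\ I (i + d)].

Definition index_set I : Prop :=
  I #= [set: F] /\
  forall d, 0 < d -> shift_set I d #= [set: F] \/ shift_set I d = set0.

End IndexSets.

Section LatinSquares.
Context {F : realFieldType} {X : Type}.
Implicit Types (I : set F) (L : F -> F -> X) (d D : F).

Definition latin_square I L : Prop :=
  forall i, I i ->
    set_bij I [set: X] (fun j => L i j) /\ set_bij I [set: X] (fun j => L j i).

Definition row_complete_at I L d : Prop :=
  forall x y : X, x <> y ->
    exists! p : F * F,
      [/\ I p.1, shift_set I d p.2, L p.1 p.2 = x & L p.1 (p.2 + d) = y].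

Definition column_complete_at I L d : Prop :=
  forall x y : X, x <> y ->
    exists! p : F * F,
      [/\ shift_set I d p.1, I p.2, L p.1 p.2 = x & L (p.1 + d) p.2 = y].

Definition D_complete_latin_square D I L : Prop :=
  latin_square I L /\
  forall d, 0 < d <= D -> shift_set I d !=set0 ->
    row_complete_at I L d /\ column_complete_at I L d.

Definition vatican_square I L : Prop :=
  latin_square I L /\
  forall d, 0 < d -> shift_set I d !=set0 ->
    row_complete_at I L d /\ column_complete_at I L d.

End LatinSquares.

Section Terraces.
Context {F : realFieldType} {G : groupType}.
Implicit Types (I : set F) (a : F -> G) (d D : F).

(* a_(d) *)
Definition quotient_map a d (i : F) : G := ((a i)^-1 * a (i + d)%R)%g.

Definition quotient_bij I a d : Prop :=
  set_bij (shift_set I d) [set g : G | g <> 1%g] (quotient_map a d).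

Definition directed_T_terrace D I a : Prop :=
  set_bij I [set: G] a /\
  forall d, 0 < d <= D -> shift_set I d !=set0 -> quotient_bij I a d.

Definition directed_Tinfty_terrace I a : Prop :=
  set_bij I [set: G] a /\
  forall d, 0 < d -> shift_set I d !=set0 -> quotient_bij I a d.

End Terraces.

(* Main.v *)
(** The square [L i j = a(i)^-1 a(j)] works: if [L i j = x] and [L i (j + d) = y]
    then [a_(d) j = x^-1 y], which determines [j], and then [a i = a j x^-1]
    determines [i]; columns are similar, with [a_(d) i = x y^-1]. *)
Require Import Defs.
From mathcomp Require Import all_boot all_order all_algebra.
From mathcomp Require Import boolp classical_sets functions cardinality.

Local Open Scope classical_set_scope.
Local Open Scope card_scope.
Local Open Scope ring_scope.

(** The Cayley table of [G] with row [i] labelled by [(a i)^-1] and column [j] by [a j]. *)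
Definition quotient_square {F : realFieldType} {G : groupType} (a : F -> G)
  (i j : F) : G := ((a i)^-1 * a j)%g.

(** A row is [a] followed by a left translation, a column is [a] followed by inversion and a right
    translation; translations and inversion permute [G]. *)
Lemma quotient_square_latin (F : realFieldType) (G : groupType) (I : set F)
    (a : F -> G) :
  set_bij I [set: G] a -> latin_square I (quotient_square a).
Proof.
move=> [_ a_inj a_surj] i _; rewrite /quotient_square; split; split => //.
- by move=> j k Ij Ik /mulgI; apply: a_inj.
- move=> g _; have [j Ij aj] := a_surj (a i * g)%g Logic.I.
  by exists j => //; rewrite aj mulKg.
- by move=> j k Ij Ik /mulIg /invg_inj; apply: a_inj.
- move=> g _; have [j Ij aj] := a_surj (a i * g^-1)%g Logic.I.
  by exists j => //; rewrite aj invgM invgK mulgVK.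
Qed.

Lemma quotient_square_row_complete (F : realFieldType) (G : groupType)
    (I : set F) (a : F -> G) (d : F) :
  set_bij I [set: G] a -> quotient_bij I a d ->
  row_complete_at I (quotient_square a) d.
Proof.
move=> [_ a_inj a_surj] [_ q_inj q_surj] x y xy; rewrite /quotient_square.
(* Since [x <> y], the element [x^-1 * y] is not the identity, so [a_(d)] attains it. *)
have [|j Ij qj] := q_surj (x^-1 * y)%g.
  by move=> /= /(congr1 (fun z => x * z)%g); rewrite mulVKg mulg1 => /esym.
have [i Ii ai] := a_surj (a j * x^-1)%g Logic.I.
exists (i, j); split => [|[i' j'] /= [Ii' Ij' Lx Ly]].
  split=> //=; rewrite ai invgM invgK ?mulgVK //.
  by rewrite -mulgA -/(quotient_map a d j) qj mulVKg.
(* The factor [a i'] cancels in [x^-1 * y], leaving [a_(d) j']. *)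
have jj' : j = j'.
  apply: q_inj; rewrite ?inE // qj /quotient_map -Lx -Ly.
  by rewrite invgM invgK -mulgA mulVKg.
congr pair => //; apply: a_inj; rewrite ?inE //.
by rewrite ai jj' -Lx invgM invgK mulVKg.
Qed.

Lemma quotient_square_column_complete (F : realFieldType) (G : groupType)
    (I : set F) (a : F -> G) (d : F) :
  set_bij I [set: G] a -> quotient_bij I a d ->
  column_complete_at I (quotient_square a) d.
Proof.
move=> [_ a_inj a_surj] [_ q_inj q_surj] x y xy; rewrite /quotient_square.
have [|i Ii qi] := q_surj (x * y^-1)%g.
  by move=> /= /(congr1 (fun z => z * y)%g); rewrite mulgVK mul1g.
have [j Ij aj] := a_surj (a i * x)%g Logic.I.
exists (i, j); split => [|[i' j'] /= [Ii' Ij' Lx Ly]].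
  split=> //=; rewrite aj ?mulKg // mulgA.
  (* The quotient appears reversed here, so it equals [y * x^-1], which sends [x] to [y]. *)
  have -> : ((a (i + d)%R)^-1 * a i = (quotient_map a d i)^-1)%g.
    by rewrite /quotient_map invgM invgK.
  by rewrite qi invgM invgK mulgVK.
(* The common factor [a j'] now stands on the right, so it cancels in [x * y^-1]. *)
have ii' : i = i'.
  apply: q_inj; rewrite ?inE // qi /quotient_map -Lx -Ly.
  by rewrite invgM invgK mulgA mulgK.
congr pair => //; apply: a_inj; rewrite ?inE //.
by rewrite aj ii' -Lx mulVKg.
Qed.

Theorem theorem2p1 (F : realFieldType) (I : set F) (G : groupType)
    (G_infinite : infinite_set [set: G]) (I_index : index_set I)
    (card_I : I #= [set: G]) :
  (forall D : F, 0 < D ->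
    (exists a : F -> G, directed_T_terrace D I a) ->
    exists (X : Type) (L : F -> F -> X),
      [set: X] #= [set: G] /\ D_complete_latin_square D I L) /\
  ((exists a : F -> G, directed_Tinfty_terrace I a) ->
    exists (X : Type) (L : F -> F -> X),
      [set: X] #= [set: G] /\ vatican_square I L).
Proof.
(* Completeness at one [d] needs only that [a] and [a_(d)] are bijective, so one argument serves
   both ranges of [d]. *)
split=> [D _|] [a [a_bij q_bij]]; exists G, (quotient_square a);
  (split; first exact: card_eqxx); (split; first exact: quotient_square_latin);
  move=> d d_range Id; have qd := q_bij d d_range Id; split;
  by [apply: quotient_square_row_complete
     | apply: quotient_square_column_complete].
Qed.
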